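(* Let $p$ be a prime, let $G$ be a finite abelian $p$-group, let $\sigma$ be a skew-morphism of $G$, and let $X=G\langle\sigma\rangle\le\operatorname{Sym}(G)$ be the associated skew-product group (with $G$ identified with its left regular representation). Write $|\sigma|=kp^m$ with $m\ge 0$ and $\gcd(k,p)=1$. Then: (1) the commutator subgroup $X'$ is an abelian $p$-group; (2) $P=G\langle\sigma^k\rangle$ is the unique Sylow $p$-subgroup of $X$; (3) $X=P\rtimes\langle\sigma^{p^m}\rangle$, where $\langle\sigma^{p^m}\rangle$ acts faithfully (by conjugation) on both $P$ and its Frattini quotient $P/\Phi(P)$.
   Context: A skew-morphism of a finite group $G$ is a permutation $\sigma$ of $G$ fixing the identity element for which there exists a function $\pi\colon G\to\mathbb{Z}$ with $\sigma(gh)=\sigma(g)\sigma^{\pi(g)}(h)$ for all $g,h\in G$. Its order $|\sigma|$ is its order as a permutation. Let $L_G=\{L_g\mid g\in G\}\le\operatorname{Sym}(G)$, $L_g(h)=gh$, be the left regular representation. The product set $X=L_G\langle\sigma\rangle$ is a subgroup of $\operatorname{Sym}(G)$, called the skew-product group of $G$ by $\sigma$. One identifies $G$ with $L_G$ and writes $X=G\langle\sigma\rangle$. $\Phi(P)$ denotes the Frattini subgroup of $P$. *)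

(* Defs.v *)
From mathcomp Require Import all_boot all_fingroup all_solvable ssralg ssrint.

Set Implicit Arguments.
Unset Strict Implicit.
Unset Printing Implicit Defensive.

Import GroupScope.

Definition expgz (hT : finGroupType) (x : hT) (z : int) : hT :=
  match z with
  | Posz n => x ^+ n
  | Negz n => x ^- n.+1
  end.

Definition skew_morphism (gT : finGroupType) (sigma : {perm gT}) : Prop :=
  sigma 1 = 1 /\
  exists pi : gT -> int,
    forall g h : gT, sigma (g * h) = sigma g * expgz sigma (pi g) h.

Definition lreg (gT : finGroupType) (g : gT) : {perm gT} := perm (mulgI g).

Definition lreg_set (gT : finGroupType) : {set {perm gT}} :=
  [set lreg g | g in [set: gT]].

(* Permutations multiply left to right: (s * t) x = t (s x).  The set of the
   composites L_g \o tau^i, usually written G<tau>, is therefore a product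
   with the cyclic factor on the left. *)
Definition lreg_mul_cycle (gT : finGroupType) (tau : {perm gT}) :
    {set {perm gT}} :=
  <[tau]> * lreg_set gT.

Lemma lregM (gT : finGroupType) (g h : gT) : lreg g * lreg h = lreg (h * g).
Proof. by apply/permP=> x; rewrite permM !permE mulgA. Qed.

Lemma lreg_group_set (gT : finGroupType) : group_set (lreg_set gT).
Proof.
apply/group_setP; split.
  by apply/imsetP; exists 1; rewrite ?inE //; apply/permP=> x; rewrite !permE mul1g.
move=> _ _ /imsetP[g _ ->] /imsetP[h _ ->].
by rewrite lregM; apply: imset_f; rewrite inE.
Qed.

Canonical lreg_group (gT : finGroupType) : {group {perm gT}} :=
  Group (lreg_group_set gT).

Lemma skew_product_group_set (gT : finGroupType) (sigma : {perm gT}) :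
  skew_morphism sigma -> group_set (lreg_mul_cycle sigma).
Proof.
move=> [_ [pi skew]]; rewrite /lreg_mul_cycle.
pose L := lreg_group gT.
have expz_cycle z : expgz sigma z \in <[sigma]>.
  by case: z => n /=; rewrite ?groupV mem_cycle.
have sub1 g : lreg g * sigma \in <[sigma]> * L.
  apply/mulsgP; exists (expgz sigma (pi g)) (lreg (sigma g)) => //.
    by apply: imset_f; rewrite inE.
  by apply/permP=> x; rewrite !permM !permE skew.
have subn n g : lreg g * sigma ^+ n \in <[sigma]> * L.
  elim: n g => [|n IHn] g.
    rewrite mulg1 -[lreg g]mul1g mem_mulg //.
    by apply: imset_f; rewrite inE.
  rewrite expgS mulgA.
  have /mulsgP[s _ s_sigma /imsetP[h _ ->] ->] := sub1 g.
  rewrite -mulgA; have /mulsgP[t l t_sigma lL ->] := IHn h.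
  by rewrite mulgA mem_mulg ?groupM.
have sLC : L * <[sigma]> \subset <[sigma]> * L.
  by apply/subsetP=> _ /mulsgP[_ _ /imsetP[g _ ->] /cycleP[n ->] ->].
apply/(@comm_group_setP _ <[sigma]>%G L)/eqP; rewrite eqEsubset sLC andbT.
by rewrite -invSg !invMG.
Qed.

Definition skew_product (gT : finGroupType) (sigma : {perm gT})
    (skew_sigma : skew_morphism sigma) : {group {perm gT}} :=
  Group (skew_product_group_set skew_sigma).

(* Main.v *)
(** [X] is the product of the abelian groups [G] and [<sigma>], so [X'] is
    abelian by Ito's theorem.  A normal [p']-subgroup of [X] lies in the Hall
    [p']-subgroup of [<sigma>], which is contained in the stabiliser of [1];
    as [G] is transitive, this stabiliser contains no nontrivial normal
    subgroup of [X], whence ['O_p^'(X) = 1].  Therefore [X'] is a [p]-group and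
    the Sylow [p]-subgroup [P], which contains [X'], is normal.  The elements
    of the cyclic [p']-group [Q] centralising [P] form a normal [p']-subgroup
    of [X = P Q], so [Q] acts faithfully on [P], and by coprime action it also
    acts faithfully on [P / Phi(P)]. *)
Require Import Defs.
From mathcomp Require Import all_boot all_fingroup all_solvable.

Set Implicit Arguments.
Unset Strict Implicit.
Unset Printing Implicit Defensive.

Import GroupScope.

Section AbelianFactors.

Variables (gT : finGroupType) (A B X : {group gT}).
Hypotheses (abA : abelian A) (abB : abelian B) (defX : A * B = X).

Lemma mulC_factors : B * A = X.
Proof. by rewrite -(invGid X) -defX invMG. Qed.

(** Both factors normalise [[~: A, B]], and modulo it their abelian images commute, so the quotient
    of [X] is abelian. *)
Lemma der1_abelian_mul : X^`(1) \subset [~: A, B].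
Proof.
have nR : A <*> B \subset 'N([~: A, B]) := commg_norm A B.
have defY : A <*> B = X by rewrite comm_joingE // /commute mulC_factors.
have [nA nB] : A \subset 'N([~: A, B]) /\ B \subset 'N([~: A, B]).
  by apply/andP; rewrite -join_subG.
apply: der1_min; rewrite -defY // defY -defX quotientMl // abelianM.
by rewrite !quotient_abelian // quotient_cents2r // [[~: B, A]]commGC.
Qed.

(* Ito's theorem: writing [b ^ a1 = a2 * b2] and [a ^ b1 = b3 * a3], both
   [[~ a, b] ^ (a1 * b1)] and [[~ a, b] ^ (b1 * a1)] equal [[~ a3, b2]]. *)
Lemma Ito_abelian_der1 : abelian X^`(1).
Proof.
apply: (abelianS der1_abelian_mul); rewrite abelian_gen.
have sAX : A \subset X by rewrite -defX mulG_subl.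
have sBX : B \subset X by rewrite -defX mulG_subr.
suffices swap a b a1 b1 : a \in A -> b \in B -> a1 \in A -> b1 \in B ->
    [~ a, b] ^ (a1 * b1) = [~ a, b] ^ (b1 * a1).
  apply/centsP=> _ /imset2P[a b Aa Bb ->] _ /imset2P[a1 b1 Aa1 Bb1 ->].
  (* Since [[~ a1, b1]] is [a1^-1 * b1^-1 * (a1 * b1)], applying [swap] to the inverses of [a1] and
     [b1] makes the two conjugations cancel. *)
  apply/commgP/conjg_fixP; rewrite (commgEl a1) conjgE mulgA conjgM.
  by rewrite swap ?groupV // -invMg conjgKV.
move=> Aa Bb Aa1 Bb1.
have [Xa Xb] := (subsetP sAX a Aa, subsetP sBX b Bb).
have [Xa1 Xb1] := (subsetP sAX a1 Aa1, subsetP sBX b1 Bb1).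
have /mulsgP[a2 b2 Aa2 Bb2 ba1] : b ^ a1 \in A * B by rewrite defX groupJ.
have /mulsgP[b3 a3 Bb3 Aa3 ab1] : a ^ b1 \in B * A by rewrite mulC_factors groupJ.
have fixA x y : x \in A -> y \in A -> x ^ y = x.
  by move=> Ax Ay; apply/conjg_fixP/commgP/(centsP abA).
have fixB x y : x \in B -> y \in B -> x ^ y = x.
  by move=> Bx By; apply/conjg_fixP/commgP/(centsP abB).
have triv (H : {group gT}) x y : abelian H -> x \in H -> y \in H -> [~ x, y] = 1.
  by move=> abH Hx Hy; apply/eqP/commgP/(centsP abH).
have eq12 : [~ a, b] ^ (a1 * b1) = [~ a3, b2].
  rewrite conjgM conjRg (fixA a a1) // ba1 commgMJ (triv A a a2) // conj1g mulg1.
  by rewrite conjRg ab1 (fixB b2 b1) // commMgJ (triv B b3 b2) // conj1g mul1g.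
have eq21 : [~ a, b] ^ (b1 * a1) = [~ a3, b2].
  rewrite conjgM conjRg (fixB b b1) // ab1 commMgJ (triv B b3 b) // conj1g mul1g.
  by rewrite conjRg ba1 (fixA a3 a1) // commgMJ (triv A a3 a2) // conj1g mulg1.
by rewrite eq12 eq21.
Qed.

End AbelianFactors.

Section SylowStructure.

Variables (gT : finGroupType) (p : nat) (X : {group gT}).
Hypotheses (abX' : abelian X^`(1)) (p'X1 : 'O_p^'(X) = 1).

Lemma pgroup_der1 : p.-group X^`(1).
Proof.
rewrite -(dprodW (nilpotent_pcoreC p (abelian_nil abX'))).
have -> : 'O_p^'(X^`(1)) = 1.
  apply/trivgP; rewrite -p'X1 pcore_max ?pcore_pgroup //.
  exact: char_normal_trans (pcore_char _ _) (der_normal 1 X).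
by rewrite mulg1 pcore_pgroup.
Qed.

Lemma pcore_Sylow : p.-Sylow(X) 'O_p(X).
Proof.
have [S sylS] := Sylow_exists p X.
have nsSX : S <| X.
  apply: sub_der1_normal (pHall_sub sylS).
  apply: subset_trans (pcore_sub_Hall sylS).
  exact: pcore_max pgroup_der1 (der_normal 1 X).
by rewrite (normal_Hall_pcore sylS nsSX).
Qed.

Lemma unique_pcore_Sylow : 'Syl_p(X) = [set 'O_p(X)%G].
Proof.
apply/setP=> S; rewrite !inE.
apply/idP/eqP=> [sylS | ->]; last exact: pcore_Sylow.
exact/group_inj/(uniq_normal_Hall pcore_Sylow (pcore_normal p X))/(Hall_max sylS).
Qed.

(** Normality of [D] in [X] comes from both factors: ['O_p(X)] centralises [D], and [Q] is
    abelian. *)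
Lemma cent_pcore_compl (Q D : {group gT}) :
    abelian Q -> p^'.-group Q -> 'O_p(X) * Q = X -> 
  D \subset Q -> D \subset 'C('O_p(X)) -> D :=: 1.
Proof.
move=> abQ p'Q defX sDQ cPD; apply/trivgP; rewrite -p'X1.
apply: pcore_max; first exact: pgroupS p'Q.
rewrite /normal -defX (subset_trans sDQ) ?mulG_subr //= mul_subG //.
  by apply: cents_norm; rewrite centsC.
exact: cents_norm (centsS sDQ abQ).
Qed.

End SylowStructure.

Lemma coprime_cent_Phi (gT : finGroupType) (P D : {group gT}) :
    solvable P -> D \subset 'N(P) -> coprime #|P| #|D| ->
  [~: D, P] \subset 'Phi(P) -> D \subset 'C(P).
Proof.
move=> solP nPD coPD sRPhi.
have nPhiP := normal_norm (Phi_normal P).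
have nPhiD : D \subset 'N('Phi(P)) := subset_trans nPD (gFnorms _ _).
have quo : 'C_P(D) / 'Phi(P) = P / 'Phi(P).
  rewrite coprime_quotient_cent ?Phi_sub //; apply/setIidPl.
  by rewrite quotient_cents2 // commGC.
have sCP : P \subset 'Phi(P) * 'C_P(D).
  rewrite -quotientSK ?quo //.
rewrite centsC; apply/setIidPl.
rewrite -[LHS]genGid; apply: Phi_nongen; apply/eqP.
rewrite eqEsubset join_subG Phi_sub subsetIl /=.
by rewrite (subset_trans sCP) // mul_subG ?joing_subl ?joing_subr.
Qed.

Section SkewProduct.

Variables (gT : finGroupType) (sigma : {perm gT}).
Hypothesis skew_sigma : skew_morphism sigma.

Lemma cycle_fix1 s : s \in <[sigma]> -> s 1 = 1.
Proof.
case/cycleP=> n ->; rewrite permX.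
by elim: n => //= n ->; case: skew_sigma.
Qed.

Lemma lreg_cycle_TI : <[sigma]> :&: lreg_group gT = 1.
Proof.
apply/trivgP/subsetP=> s /setIP[Cs /imsetP[g _ def_s]].
have := cycle_fix1 Cs; rewrite def_s permE mulg1 inE => ->.
by apply/eqP/permP=> x; rewrite !permE mul1g.
Qed.

Lemma cycle_core (N : {group {perm gT}}) :
  N \subset <[sigma]> -> lreg_group gT \subset 'N(N) -> N :=: 1.
Proof.
move=> sNC nNL; apply/trivgP/subsetP=> x Nx; rewrite inE; apply/eqP/permP=> g.
have Lg : lreg g \in lreg_group gT by apply: imset_f.
(* Translation by [g] carries 1 to [g], so this conjugate fixes 1 exactly when [x] fixes [g]. *)
have: x ^ (lreg g)^-1 \in N by rewrite memJ_norm // groupV (subsetP nNL).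
move/(subsetP sNC)/cycle_fix1; rewrite conjgE invgK !permM perm1.
move/(canRL (permKV _)); rewrite !permE mulg1 //.
Qed.

End SkewProduct.

Lemma lreg_inj (gT : finGroupType) : injective (@lreg gT).
Proof. by move=> g h /permP/(_ 1); rewrite !permE !mulg1. Qed.

Lemma card_lreg (gT : finGroupType) : #|lreg_group gT| = #|gT|.
Proof. by rewrite card_imset ?cardsT //; apply: lreg_inj. Qed.

Lemma abelian_lreg (gT : finGroupType) :
  abelian [set: gT] -> abelian (lreg_group gT).
Proof.
move=> abG; apply/centsP=> _ /imsetP[g _ ->] _ /imsetP[h _ ->].
by rewrite /commute !lregM (centsP abG) ?inE.
Qed.

Theorem theorem1 (gT : finGroupType) (p : nat) (sigma : {perm gT})
    (skew_sigma : skew_morphism sigma) (k m : nat) :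
  prime p ->
  abelian [set: gT] ->
  p.-group [set: gT] ->
  #[sigma] = (k * p ^ m)%N ->
  coprime k p ->
  let X := skew_product skew_sigma in
  let Q := <[sigma ^+ (p ^ m)%N]> in
  (abelian X^`(1) /\ p.-group X^`(1)) /\
  exists P : {group {perm gT}},
    [/\ P :=: lreg_mul_cycle (sigma ^+ k),
        'Syl_p(X) = [set P],
        P ><| Q = X,
        [acts Q, on P | 'J] /\ [faithful Q, on P | 'J] &
        [acts Q, on P / 'Phi(P) | 'Q] /\
        [faithful Q, on P / 'Phi(P) | 'Q]].
Proof.
move=> p_pr abG pG o_sigma co_kp X Q.
pose L := lreg_group gT; pose C := <[sigma]>%G.
have defX : C * L = X by [].
have sLX : L \subset X by rewrite -defX mulG_subr.
have sCX : C \subset X by rewrite -defX mulG_subl.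
have pL : p.-group L by rewrite /pgroup card_lreg -cardsT.
have k_gt0 : 0 < k.
  by have := order_gt0 sigma; rewrite o_sigma muln_gt0 => /andP[].
have p'k : p^'.-nat k by rewrite p'natE // -prime_coprime // coprime_sym.
have oQ : #|Q| = k.
  by rewrite -orderE orderXdiv o_sigma ?dvdn_mull // mulnK ?expn_gt0 ?prime_gt0.
have oCp : #[sigma ^+ k] = (p ^ m)%N.
  by rewrite orderXdiv o_sigma ?dvdn_mulr // mulKn.
have oX : #|X| = (k * (p ^ m * #|L|))%N.
  by rewrite -defX TI_cardMg ?lreg_cycle_TI // -orderE o_sigma mulnA.
have p_Lpm : p.-nat (p ^ m * #|L|)%N by rewrite pnatM pnatX pnat_id.
have p_part : (#|X|`_p = p ^ m * #|L|)%N.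
  rewrite oX partnM ?muln_gt0 ?k_gt0 ?expn_gt0 ?cardG_gt0 ?prime_gt0 //.
  by rewrite part_p'nat // mul1n part_pnat_id.
have p'_part : (#|X|`_p^' = k)%N.
  rewrite oX partnM ?muln_gt0 ?k_gt0 ?expn_gt0 ?cardG_gt0 ?prime_gt0 //.
  by rewrite part_pnat_id // part_p'nat ?pnatNK // muln1.
have sQC : Q \subset C by rewrite cycleX.
have hallQ : p^'.-Hall(X) Q.
  by rewrite pHallE (subset_trans sQC sCX) /= oQ p'_part.
have p'X1 : 'O_p^'(X) = 1.
  apply: (cycle_core skew_sigma).
    exact: subset_trans (pcore_sub_Hall hallQ) sQC.
  exact: subset_trans sLX (gFnorm _ _).
have abX' : abelian X^`(1).
  by apply: (Ito_abelian_der1 _ _ defX); rewrite ?cycle_abelian ?abelian_lreg.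
have sylP := pcore_Sylow abX' p'X1.
have pP : p.-group 'O_p(X) := pcore_pgroup p X.
have nsPX := pcore_normal p X.
have defPQ : 'O_p(X) ><| Q = X by apply/(sdprod_normal_p'HallP nsPX hallQ).
have nPQ : Q \subset 'N('O_p(X)) by case/sdprodP: defPQ.
have coPQ : coprime #|'O_p(X)| #|Q| := pnat_coprime pP (pHall_pgroup hallQ).
have abQ : abelian Q := cycle_abelian _.
have cent1 := cent_pcore_compl p'X1 abQ (pHall_pgroup hallQ) (sdprodW defPQ).
have nPhi : Q \subset 'N('Phi('O_p(X))) := subset_trans nPQ (gFnorms _ _).
split; first by split=> //; apply: pgroup_der1.
exists 'O_p(X)%G; split=> //.
(* Both factors are p-subgroups of [X], so they lie in the normal Sylow subgroup; equality follows
   by comparing orders, both [p ^ m * #|L|]. *)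
- apply/esym/eqP; rewrite eqEcard.
  rewrite mul_subG ?(sub_normal_Hall sylP nsPX) //=; last 2 first.
  + by rewrite /pgroup -orderE oCp pnatX pnat_id.
  + exact: subset_trans (cycleX _ _) sCX.
  rewrite (card_Hall sylP) p_part TI_cardMg -?orderE ?oCp //.
  apply/trivgP; rewrite -(lreg_cycle_TI skew_sigma) setSI //.
  exact: cycleX.
- exact: (unique_pcore_Sylow abX' p'X1).
- split; first by rewrite astabsJ.
  rewrite /faithful astabJ.
  by rewrite (cent1 'C_(<[_]>)('O_p(X))%G) ?subsetIl ?subsetIr.
split; first by rewrite actsQ.
(* [D] is the kernel on the Frattini quotient; coprime action makes it centralise ['O_p(X)], so
   [cent1] applies again. *)
pose D := 'C_(<[sigma ^+ (p ^ m)]>)('O_p(X) / 'Phi('O_p(X)) | 'Q)%G.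
have sDQ : D \subset Q := subsetIl _ _.
have sDN := subset_trans sDQ nPhi.
apply/trivgP/(cent1 D sDQ)/coprime_cent_Phi.
- exact: pgroup_sol pP.
- exact: subset_trans sDQ nPQ.
- exact: coprimegS sDQ coPQ.
by rewrite -sub_astabQR ?subsetIr // normal_norm ?Phi_normal.
Qed.
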